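(* Let $A\in\mathbb{R}^{m\times n}$ be semi-monotone and let $A=P_1-R_1+S_1=P_2-R_2+S_2$ be two double proper weak regular splittings of $A$. Suppose $A=P_3-R_3+S_3$ is a double proper regular splitting with $N(S_3)\supseteq N(P_3)$, $R(S_3)\subseteq R(P_3)$, and, for $i=1,2$, $1\notin\sigma(S_3P_i^{\dagger})$ and $\widehat{A}_i^{\dagger}\geq 0$, where $\widehat{A}_i=(I-S_3P_i^{\dagger})A$. Let $\widehat{P}_i=P_3$ and $\widehat{R}_i=R_3-S_3P_i^{\dagger}R_i$ for $i=1,2$. If $\widehat{P}_1^{\dagger}\widehat{A}_1\geq\widehat{P}_2^{\dagger}\widehat{A}_2$ and $\widehat{P}_1^{\dagger}\widehat{R}_1\geq\widehat{P}_2^{\dagger}\widehat{R}_2$, then $\rho(W_{13})\leq\rho(W_{23})<1$, where for $i=1,2$ $$W_{i3}=\begin{pmatrix} P_3^{\dagger}R_3-P_3^{\dagger}S_3P_i^{\dagger}R_i & P_3^{\dagger}S_3P_i^{\dagger}S_i\\ I & 0\end{pmatrix}.$$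
   Context: For $M\in\mathbb{R}^{m\times n}$, $M^{\dagger}$ is its Moore–Penrose inverse, $R(M)$, $N(M)$ its range and null space; inequalities are entrywise; $\rho$ is the spectral radius, $\sigma$ the spectrum. $A$ is semi-monotone if $A^{\dagger}\geq0$. A double splitting $A=P-R+S$ is a double proper splitting if $R(P)=R(A)$ and $N(P)=N(A)$; it is double proper regular if moreover $P^{\dagger}\geq0$, $R\geq0$, $S\leq0$; double proper weak regular if moreover $P^{\dagger}\geq 0$, $P^{\dagger}R\geq 0$, $P^{\dagger}S\leq 0$. *)

(* Defs.v *)
From HB Require Import structures.
From mathcomp Require Import all_boot all_order all_algebra.
From mathcomp Require Import boolp classical_sets reals.
From mathcomp Require Import complex.
Set Implicit Arguments. Unset Strict Implicit. Unset Printing Implicit Defensive.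
Import Order.TTheory GRing.Theory Num.Theory.
Local Open Scope ring_scope.

Section Defs.
Variable R : realType.

Definition is_MP_inverse m n (A : 'M[R]_(m, n)) (X : 'M[R]_(n, m)) : Prop :=
  [/\ A *m X *m A = A, X *m A *m X = X,
      (A *m X)^T = A *m X & (X *m A)^T = X *m A].

(* Moore-Penrose inverse A^dagger (the unique matrix satisfying the Penrose
   equations; 0 is only a dummy default, never used since it always exists). *)
Definition mpinv m n (A : 'M[R]_(m, n)) : 'M[R]_(n, m) :=
  xget 0 [set X | is_MP_inverse A X].

Definition mx_nonneg m n (A : 'M[R]_(m, n)) : Prop := forall i j, 0 <= A i j.
Definition mx_nonpos m n (A : 'M[R]_(m, n)) : Prop := forall i j, A i j <= 0.
Definition mx_le m n (A B : 'M[R]_(m, n)) : Prop := forall i j, A i j <= B i j.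

Definition mx_range m n (A : 'M[R]_(m, n)) : set 'cV[R]_m :=
  [set y | exists x : 'cV[R]_n, y = A *m x].
Definition mx_null m n (A : 'M[R]_(m, n)) : set 'cV[R]_n :=
  [set x | A *m x = 0].

Definition semi_monotone m n (A : 'M[R]_(m, n)) : Prop := mx_nonneg (mpinv A).

Definition double_proper_splitting m n (A P Q S : 'M[R]_(m, n)) : Prop :=
  [/\ A = P - Q + S, mx_range P = mx_range A & mx_null P = mx_null A].

Definition double_proper_regular m n (A P Q S : 'M[R]_(m, n)) : Prop :=
  [/\ double_proper_splitting A P Q S, mx_nonneg (mpinv P), mx_nonneg Q
    & mx_nonpos S].

Definition double_proper_weak_regular m n (A P Q S : 'M[R]_(m, n)) : Prop :=
  [/\ double_proper_splitting A P Q S, mx_nonneg (mpinv P),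
      mx_nonneg (mpinv P *m Q) & mx_nonpos (mpinv P *m S)].

Definition cmod (z : R[i]) : R :=
  Num.sqrt (complex.Re z ^+ 2 + complex.Im z ^+ 2).

Definition spectrum n (M : 'M[R]_n) : set R[i] :=
  [set z | eigenvalue (map_mx (real_complex R) M) z].

Definition spectral_radius n (M : 'M[R]_n) : R :=
  sup [set cmod z | z in spectrum M].

End Defs.

(* Main.v *)
Require Import Defs.
From HB Require Import structures.
From mathcomp Require Import all_boot all_order all_algebra.
From mathcomp Require Import boolp classical_sets reals.
From mathcomp Require Import complex.
From mathcomp Require Import ring lra.
Import Order.TTheory GRing.Theory Num.Theory.
Local Open Scope ring_scope.
Set Implicit Arguments.
Unset Strict Implicit.

(* Each [A - S3 Pi^+ A] splits as [P3 - Ni] with [Ni >= 0], and [W_i3] is the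
   block companion matrix of [(Bi, Ci)], where [Bi, Ci >= 0] and
   [Bi + Ci = P3^+ Ni].  If [z] is an eigenvalue of [W_i3] with [l = |z|], the
   moduli of an eigenvector give [u >= 0], [u <> 0], with
   [l^2 u <= l Bi u + Ci u].  If [l >= 1], this yields [u <= (Bi + Ci) u], which
   the nonnegativity of the pseudoinverse of [P3 - Ni] forbids.  If [l < 1], the
   hypotheses [B1 + C1 <= B2 + C2] and [B1 >= B2] give
   [l^2 u <= l B2 u + C2 u], so [(l u, u)] is subinvariant for [l^-1 W_23] and
   [l <= rho(W_23)].  This last step needs only that a nonnegative matrix with
   [v <= W v] for some nonzero [v >= 0] has an eigenvalue of modulus at least 1:
   otherwise [sum_k |W^k v|] would be bounded, although [W^k v >= v]. *)

(** * Existence of the Moore-Penrose inverse and its two projections *)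

Lemma gram_unitmx (R : realFieldType) (r n : nat) (U : 'M[R]_(r, n)) :
  row_free U -> U *m U^T \in unitmx.
Proof.
move=> Ufree; rewrite -row_free_unit; apply: inj_row_free => v vG0.
suff vU0 : v *m U = 0 by apply: (row_free_inj Ufree); rewrite mul0mx.
have : (v *m U) *m (v *m U)^T = 0 by rewrite trmx_mul mulmxA -(mulmxA v) vG0 mul0mx.
move/matrixP/(_ ord0 ord0); rewrite !mxE => /psumr_eq0P sq0.
apply/matrixP => i j; rewrite ord1 [RHS]mxE; apply/eqP.
have /eqP : (v *m U) ord0 j * (v *m U)^T j ord0 = 0.
  by apply: sq0 => // k _; rewrite [X in _ * X]mxE -expr2 sqr_ge0.
by rewrite [X in _ * X]mxE mulf_eq0 orbb.
Qed.

(** Full-rank factorization formula: [U^T *m invmx (U *m U^T)] is a right inverse of [U] and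
    [invmx (L^T *m L) *m L^T] a left inverse of [L], so both products collapse to symmetric
    projections. *)
Lemma MP_inverse_mulmx (R : realType) (m r n : nat)
    (L : 'M[R]_(m, r)) (U : 'M[R]_(r, n)) :
  U *m U^T \in unitmx -> L^T *m L \in unitmx ->
  is_MP_inverse (L *m U) (U^T *m invmx (U *m U^T) *m (invmx (L^T *m L) *m L^T)).
Proof.
move=> UU LL; set GU := invmx _; set GL := invmx _.
have GLt : GL^T = GL by rewrite trmx_inv trmx_mul trmxK.
have GUt : GU^T = GU by rewrite trmx_inv trmx_mul trmxK.
have UG : U *m (U^T *m GU) = 1%:M by rewrite mulmxA mulmxV.
have GLL : GL *m L^T *m L = 1%:M by rewrite -mulmxA mulVmx.
have AX : L *m U *m (U^T *m GU *m (GL *m L^T)) = L *m (GL *m L^T).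
  by rewrite -mulmxA [U *m _]mulmxA UG mul1mx.
have XA : U^T *m GU *m (GL *m L^T) *m (L *m U) = U^T *m GU *m U.
  by rewrite -mulmxA [GL *m _ *m _]mulmxA GLL mul1mx.
split.
- by rewrite AX -mulmxA [GL *m _ *m _]mulmxA GLL mul1mx.
- by rewrite XA -mulmxA [U *m _]mulmxA UG mul1mx.
- by rewrite AX !trmx_mul trmxK GLt mulmxA.
- by rewrite XA !trmx_mul trmxK GUt mulmxA.
Qed.

Lemma MP_inverse_exists (R : realType) (m n : nat) (A : 'M[R]_(m, n)) :
  exists X, is_MP_inverse A X.
Proof.
rewrite -(mulmx_base A); eexists; apply: MP_inverse_mulmx.
  by apply: gram_unitmx; exact: row_base_free.
rewrite -{2}[col_base A]trmxK; apply: gram_unitmx.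
by rewrite /row_free mxrank_tr; exact: col_base_full.
Qed.

Lemma mpinvP (R : realType) (m n : nat) (A : 'M[R]_(m, n)) :
  is_MP_inverse A (mpinv A).
Proof. exact: (@xgetPex _ 0 [set X | is_MP_inverse A X]%classic (MP_inverse_exists A)). Qed.

(** The columns of [1 - mpinv P *m P] lie in the null space of [P], so [S] kills them. *)
Lemma mulmx_null_sub (R : realType) (m1 m2 n : nat)
    (P : 'M[R]_(m1, n)) (S : 'M[R]_(m2, n)) :
  (forall x, mx_null P x -> mx_null S x) -> S *m mpinv P *m P = S.
Proof.
move=> PS; have [PXP _ _ _] := mpinvP P.
apply/eqP; rewrite -subr_eq0 -mulmxA -{2}[S]mulmx1 -mulmxBr.
apply/eqP/trmx_inj/row_matrixP => i; rewrite -tr_col colE trmx0 row0 -mulmxA.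
rewrite (PS _ _) ?trmx0 // /mx_null /=.
by rewrite mulmxA mulmxBr mulmxA PXP mulmx1 subrr mul0mx.
Qed.

(** [P *m mpinv P] fixes the range of [P], where the columns of [S] lie. *)
Lemma mulmx_range_sub (R : realType) (m n1 n2 : nat)
    (P : 'M[R]_(m, n1)) (S : 'M[R]_(m, n2)) :
  (forall y, mx_range S y -> mx_range P y) -> P *m mpinv P *m S = S.
Proof.
move=> SP; have [PXP _ _ _] := mpinvP P.
apply/trmx_inj/row_matrixP => i; rewrite -!tr_col; congr _^T.
rewrite !colE -mulmxA.
have [|x ->] := SP (S *m delta_mx i ord0); first by exists (delta_mx i ord0).
by rewrite mulmxA PXP.
Qed.

(** * Entrywise order on matrices *)

Section EntrywiseOrder.
Variable R : realType.

Lemma mx_leP m n (A B : 'M[R]_(m, n)) : mx_le A B <-> mx_nonneg (B - A).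
Proof.
by split=> AB i j; have := AB i j; rewrite !mxE subr_ge0.
Qed.

Lemma mx_le_trans m n (A B C : 'M[R]_(m, n)) : mx_le A B -> mx_le B C -> mx_le A C.
Proof. by move=> AB BC i j; apply: le_trans (AB i j) (BC i j). Qed.

Lemma mx_nonnegD m n (A B : 'M[R]_(m, n)) :
  mx_nonneg A -> mx_nonneg B -> mx_nonneg (A + B).
Proof. by move=> A0 B0 i j; rewrite mxE addr_ge0. Qed.

Lemma mx_nonnegM m n p (A : 'M[R]_(m, n)) (B : 'M[R]_(n, p)) :
  mx_nonneg A -> mx_nonneg B -> mx_nonneg (A *m B).
Proof.
by move=> A0 B0 i j; rewrite mxE; apply: sumr_ge0 => k _; apply: mulr_ge0.
Qed.

Lemma mx_nonnegZ m n a (A : 'M[R]_(m, n)) :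
  0 <= a -> mx_nonneg A -> mx_nonneg (a *: A).
Proof. by move=> a0 A0 i j; rewrite mxE mulr_ge0. Qed.

Lemma mx_nonnegN m n (A : 'M[R]_(m, n)) : mx_nonpos A -> mx_nonneg (- A).
Proof. by move=> A0 i j; rewrite mxE oppr_ge0. Qed.

Lemma mx_le_mull m n p (A : 'M[R]_(m, n)) (u v : 'M[R]_(n, p)) :
  mx_nonneg A -> mx_le u v -> mx_le (A *m u) (A *m v).
Proof. by move=> A0 /mx_leP uv; apply/mx_leP; rewrite -mulmxBr; apply: mx_nonnegM. Qed.

End EntrywiseOrder.

(** * The spectral radius as a finite maximum *)

Section Spectrum.
Local Open Scope classical_set_scope.
Local Open Scope ring_scope.
Variable R : realType.

Lemma normc_cmod (z : R[i]) : `|z| = (cmod z)%:C%C.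
Proof. exact: normc_def. Qed.

Lemma cmod_ge0 (z : R[i]) : 0 <= cmod z.
Proof. exact: sqrtr_ge0. Qed.

(** The spectrum is the finite root set of the characteristic polynomial. The base value 0 is
    harmless because moduli are nonnegative, and it agrees with [sup set0 = 0] for an empty
    spectrum. *)
Lemma spectral_radius_bigmax n (M : 'M[R]_n) : exists2 s : seq R[i],
  spectrum M = [set z | z \in s]
  & spectral_radius M = \big[Num.max/0]_(z <- s) cmod z.
Proof.
set p := char_poly (map_mx (real_complex R) M).
have [s ps] := closed_field_poly_normal p.
have spE : spectrum M = [set z | z \in s].
  apply/seteqP; split=> z; rewrite /spectrum /= eigenvalue_root_char -/p ps
    (monicP (char_poly_monic _)) scale1r root_prod_XsubC //.
exists s => //; rewrite /spectral_radius spE.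
apply/eqP; rewrite eq_le; apply/andP; split.
  have [->|/set0P E0] := eqVneq [set cmod z | z in [set z | z \in s]] set0.
    by rewrite sup0; apply: bigmax_ge_id.
  by apply: ge_sup => // _ [z /= zs <-]; apply: le_bigmax_seq.
have ub : has_ubound [set cmod z | z in [set z | z \in s]].
  exists (\big[Num.max/0]_(z <- s) cmod z) => _ [z /= zs <-].
  exact: le_bigmax_seq.
rewrite big_seq; apply: bigmax_le => [|z zs]; last first.
  by apply: ub_le_sup => //; exists z.
have [->|/set0P [_ [z zs _]]] := eqVneq [set cmod z | z in [set z | z \in s]] set0.
  by rewrite sup0.
by apply: le_trans (cmod_ge0 z) _; apply: ub_le_sup => //; exists z.
Qed.

Lemma spectral_radius_ge0 n (M : 'M[R]_n) : 0 <= spectral_radius M.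
Proof. by have [s _ ->] := spectral_radius_bigmax M; apply: bigmax_ge_id. Qed.

Lemma spectral_radius_ge n (M : 'M[R]_n) z :
  spectrum M z -> cmod z <= spectral_radius M.
Proof.
by have [s -> ->] := spectral_radius_bigmax M => zs; apply: le_bigmax_seq.
Qed.

Lemma spectral_radius_le n (M : 'M[R]_n) c : 0 <= c ->
  (forall z, spectrum M z -> cmod z <= c) -> spectral_radius M <= c.
Proof.
have [s -> ->] := spectral_radius_bigmax M => c0 zc.
by rewrite big_seq; apply: bigmax_le.
Qed.

Lemma spectral_radius_lt n (M : 'M[R]_n) c : 0 < c ->
  (forall z, spectrum M z -> cmod z < c) -> spectral_radius M < c.
Proof.
have [s -> ->] := spectral_radius_bigmax M => c0 zc.
by rewrite big_seq; apply: bigmax_lt.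
Qed.

End Spectrum.

(** * Bounded sums of powers of a matrix with spectrum in the open unit disc *)

Lemma sum_norm_recurrence (F : numFieldType) (mu M : F) (b : nat -> F) :
  `|mu| < 1 -> (forall K, \sum_(k < K) `|b k.+1 - mu * b k| <= M) ->
  forall K, \sum_(k < K) `|b k| <= (`|b 0%N| + M) / (1 - `|mu|).
Proof.
move=> mu1 bM K; rewrite ler_pdivlMr ?subr_gt0 // mulrBr mulr1 lerBlDr.
have -> : (\sum_(k < K) `|b k|) * `|mu| = \sum_(k < K) `|mu * b k|.
  by rewrite mulr_suml; apply: eq_bigr => k _; rewrite mulrC normrM.
(* The goal has become [s <= |b 0| + M + |mu| s] for the partial sum [s]. One extra term is added so
   that, once [b 0] is split off, the shifted terms [b k.+1] remain. *)
apply: (@le_trans _ _ (\sum_(k < K.+1) `|b k|)).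
  by rewrite big_ord_recr /= lerDl.
rewrite big_ord_recl /= -addrA lerD2l.
apply: (@le_trans _ _ (\sum_(k < K) (`|b k.+1 - mu * b k| + `|mu * b k|))).
  by apply: ler_sum => k _; rewrite -{1}(subrK (mu * b k) (b k.+1)) ler_normD.
by rewrite big_split lerD2r.
Qed.

(* By Cayley-Hamilton, peeling off the factors [X - mu] of the characteristic
   polynomial one by one reduces to the zero sequence. *)
Lemma sum_norm_powers_bounded (F : numClosedFieldType) (n : nat)
    (A : 'M[F]_n.+1) (v : 'cV[F]_n.+1) (i : 'I_n.+1) :
  (forall mu, eigenvalue A mu -> `|mu| < 1) ->
  exists M, forall K, \sum_(k < K) `|(A ^+ k *m v) i ord0| <= M.
Proof.
move=> A1; have [s ps] := closed_field_poly_normal (char_poly A).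
rewrite (monicP (char_poly_monic _)) scale1r in ps.
have s1 mu : mu \in s -> `|mu| < 1.
  by move=> mus; apply: A1; rewrite eigenvalue_root_char ps root_prod_XsubC.
(* Multiplying [p] by ['X] shifts [k] by one, so multiplying it by ['X - z%:P] turns [b p k] into
   [b p k.+1 - z * b p k]. *)
pose b p k := (horner_mx A p *m (A ^+ k *m v)) i ord0.
suff: exists M, forall K, \sum_(k < K) `|b 1 k| <= M.
  by case=> M MK; exists M => K; have := MK K; rewrite /b rmorph1;
    under eq_bigr do rewrite mul1mx.
have : exists M, forall K, \sum_(k < K) `|b (\prod_(z <- s) ('X - z%:P)) k| <= M.
  exists 0 => K; rewrite -ps /b Cayley_Hamilton.
  by rewrite big1 // => k _; rewrite mul0mx mxE normr0.
elim: s s1 {ps} => [|z s IH] s1 [M MK]; first by exists M; rewrite big_nil in MK.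
apply: IH => [mu mus|]; first by rewrite s1 // inE mus orbT.
set q := \prod_(z <- s) ('X - z%:P) in MK *.
exists ((`|b q 0%N| + M) / (1 - `|z|)); apply: sum_norm_recurrence.
  by rewrite s1 // mem_head.
move=> K; apply: le_trans (MK K); apply: ler_sum => k _; rewrite [in leRHS]/b.
have -> : horner_mx A (\prod_(j <- z :: s) ('X - j%:P))
    = horner_mx A q *m A - horner_mx A q *m z%:M.
  rewrite big_cons -/q mulrC rmorphM rmorphB /= horner_mx_X horner_mx_C.
  exact: mulmxBr.
rewrite /b exprS -[A * _]/(A *m _) mulmxBl -!mulmxA mul_scalar_mx -scalemxAr.
rewrite [X in _ <= `|X|]mxE [X in _ <= `|_ + X|]mxE.
by rewrite [X in _ <= `|_ + - X|]mxE.
Qed.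

(** * Subinvariant vectors of nonnegative and block companion matrices *)

Section Perron.
Variable R : realType.

Lemma eigenvalue_ge1_of_subinvariant n (W : 'M[R]_n) (v : 'cV[R]_n) :
  mx_nonneg W -> mx_nonneg v -> v <> 0 -> mx_le v (W *m v) ->
  exists2 z, spectrum W z & 1 <= cmod z.
Proof.
case: n W v => [|n] W v W0 v0 vn0 vW; first by case: vn0; apply: flatmx0.
apply: contrapT => noz; case: vn0.
set cW := map_mx (real_complex R) W.
have cW1 mu : eigenvalue cW mu -> `|mu| < 1.
  move=> muW; rewrite normc_cmod (ltcR _ 1) ltNge.
  by apply/negP => mu1; apply: noz; exists mu.
apply/matrixP => i j; rewrite ord1 mxE; apply/eqP; rewrite eq_le v0 andbT.
have [M MK] := sum_norm_powers_bounded (map_mx (real_complex R) v) i cW1.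
have vpow k : mx_le v (W ^+ k *m v).
  elim: k => [|k IH]; first by rewrite expr0 mul1mx => ? ?.
  rewrite exprS -mulmxA; apply: mx_le_trans vW _; exact: mx_le_mull.
(* Each of the [K] summands is at least [v i ord0]; [M] is complex, so the bound passes to its real
   part. *)
have {}MK K : v i ord0 *+ K <= complex.Re M.
  have : (v i ord0 *+ K)%:C%C <= M.
    apply: le_trans (MK K).
    rewrite rmorphMn /= -{1}(card_ord K) -sumr_const.
    apply: ler_sum => k _; rewrite -(rmorphXn (map_mx (real_complex R))) -map_mxM mxE.
    rewrite ger0_norm ?lecR ?vpow //.
    by apply: le_trans (v0 i ord0) _; rewrite vpow.
  by case: (M) => a b; rewrite lecE => /andP[].
rewrite leNgt; apply/negP => vi0.
(* The bound [MK] at [K = 0] gives [0 <= complex.Re M]; a large [K] then contradicts [MK] by the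
   Archimedean property. *)
have r0 : 0 <= complex.Re M / v i ord0.
  by rewrite divr_ge0 ?(ltW vi0) // -(mulr0n (v i ord0)).
have := archi_boundP r0; rewrite ltr_pdivrMr // mulr_natl.
by rewrite ltNge MK.
Qed.

(** For [l > 0], rescaling to [l^-1 *: W] gives an eigenvalue [z] of modulus at least 1, and [l z]
    is then an eigenvalue of [W]. *)
Lemma spectral_radius_subinvariant n (W : 'M[R]_n) (v : 'cV[R]_n) l :
  mx_nonneg W -> mx_nonneg v -> v <> 0 -> 0 <= l -> mx_le (l *: v) (W *m v) ->
  l <= spectral_radius W.
Proof.
move=> W0 v0 vn0; rewrite le_eqVlt => /predU1P[<- _|l0 lW].
  exact: spectral_radius_ge0.
have li0 : 0 <= l^-1 by rewrite invr_ge0 ltW.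
have [||||z] := @eigenvalue_ge1_of_subinvariant n (l^-1 *: W) v => //.
- exact: mx_nonnegZ.
- rewrite -scalemxAl => i j; rewrite [leRHS]mxE ler_pdivlMl //.
  by have := lW i j; rewrite [leLHS]mxE.
rewrite /spectrum /= map_mxZ => /eigenvalueP[x xz xn0] z1.
pose lz := l%:C%C * z.
have lzW : spectrum W lz.
  apply/eigenvalueP; exists x => //; rewrite /lz -scalerA -xz -scalemxAr scalerA.
  by rewrite -rmorphM /= divff ?gt_eqF // scale1r.
apply: le_trans (spectral_radius_ge lzW).
rewrite -lecR -normc_cmod normrM normc_cmod normc_cmod -rmorphM /= lecR.
have -> : cmod l%:C%C = l by rewrite /cmod /= expr0n addr0 sqrtr_sqr gtr0_norm.
by rewrite ler_peMr // ltW.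
Qed.

(** [eigenvalue] speaks of row vectors; invariance of the determinant under transposition yields a
    column eigenvector. *)
Lemma spectrum_right_eigenvector n (M : 'M[R]_n) z : spectrum M z ->
  exists2 x : 'cV[R[i]]_n, map_mx (real_complex R) M *m x = z *: x & x <> 0.
Proof.
case/eigenvalueP=> v vM vn0; set cM := map_mx _ M in vM *.
have : \det (z%:M - cM)^T == 0.
  by rewrite det_tr; apply/det0P; exists v; rewrite // mulmxBr vM mul_mx_scalar subrr.
case/det0P=> w wn0 /(congr1 trmx); rewrite trmx_mul trmxK trmx0 mulmxBl mul_scalar_mx.
move=> /eqP; rewrite subr_eq0 => /eqP zw; exists w^T => // w0.
by move: wn0; rewrite -[w]trmxK w0 trmx0 eqxx.
Qed.

Lemma cmod_mulmx_le m n (B : 'M[R]_(m, n)) (y : 'cV[R[i]]_n) i : mx_nonneg B ->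
  `|(map_mx (real_complex R) B *m y) i ord0|
    <= ((B *m map_mx (@cmod R) y) i ord0)%:C%C.
Proof.
move=> B0; rewrite !mxE rmorph_sum; apply: le_trans (ler_norm_sum _ _ _) _.
apply: ler_sum => k _; rewrite !mxE normrM [in leRHS]rmorphM /= -normc_cmod.
by rewrite (@ger0_norm _ (_%:C%C)) // (lecR 0).
Qed.

(* An eigenvector of the block companion matrix has the form [(z y, y)]; take
   the moduli of the entries of [y]. *)
Lemma companion_subsolution n (B C : 'M[R]_n) z :
  mx_nonneg B -> mx_nonneg C -> spectrum (block_mx B C 1%:M 0) z ->
  exists u : 'cV[R]_n, [/\ mx_nonneg u, u <> 0 &
    mx_le (cmod z ^+ 2 *: u) (cmod z *: (B *m u) + C *m u)].
Proof.
move=> B0 C0 /spectrum_right_eigenvector[x]; rewrite map_block_mx map_mx1 map_mx0.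
rewrite -[x]vsubmxK mul_block_col scale_col_mx mul1mx mul0mx addr0.
move: (usubmx x) (dsubmx x) => x1 y /eq_col_mx[xy1 xy2] xn0.
exists (map_mx (@cmod R) y); split.
- by move=> i j; rewrite mxE cmod_ge0.
- move=> y0; apply: xn0; suff y_eq0 : y = 0 by rewrite xy2 y_eq0 scaler0 col_mx0.
  apply/matrixP => i j; have /matrixP/(_ i j) := y0; rewrite !mxE => yij0.
  by apply/eqP; rewrite -normr_eq0 normc_cmod yij0.
move=> i j; rewrite ord1 -lecR.
have -> : ((cmod z ^+ 2 *: map_mx (@cmod R) y) i ord0)%:C%C = `|(z *: x1) i ord0|.
  by rewrite xy2 scalerA !mxE -expr2 normrM normrX !normc_cmod -rmorphXn -rmorphM.
rewrite -xy1 xy2 -scalemxAr.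
set By := map_mx _ B *m y; set Cy := map_mx _ C *m y.
have -> : (z *: By + Cy) i ord0 = z * By i ord0 + Cy i ord0 by rewrite 2!mxE.
have -> : forall a b : 'cV[R]_n,
    ((cmod z *: a + b) i ord0)%:C%C = `|z| * (a i ord0)%:C%C + (b i ord0)%:C%C.
  by move=> a b; rewrite 2!mxE normc_cmod -rmorphM -rmorphD.
apply: le_trans (ler_normD _ _) _; rewrite normrM.
by apply: lerD; [apply: ler_wpM2l => //|]; apply: cmod_mulmx_le.
Qed.

(** The test vector is [(l u, u)]: the lower block of the subinvariance is an equality, the upper
    one is the hypothesis on [u]. *)
Lemma companion_spectral_radius_ge n (B C : 'M[R]_n) (u : 'cV[R]_n) l :
  mx_nonneg B -> mx_nonneg C -> mx_nonneg u -> u <> 0 -> 0 <= l ->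
  mx_le (l ^+ 2 *: u) (l *: (B *m u) + C *m u) ->
  l <= spectral_radius (block_mx B C 1%:M 0).
Proof.
move=> B0 C0 u0 un0 l0 lu.
apply: (@spectral_radius_subinvariant _ _ (col_mx (l *: u) u)) => //.
- move=> i j; rewrite mxE; case: split => k; rewrite mxE; case: split => k'.
  + exact: B0.
  + exact: C0.
  + by rewrite mxE; case: eqP.
  + by rewrite mxE.
- by move=> i j; rewrite mxE; case: split => k //; apply: mx_nonnegZ.
- by rewrite -col_mx0 => /eq_col_mx[].
rewrite mul_block_col mul1mx mul0mx addr0 -scalemxAr scale_col_mx scalerA -expr2.
by move=> i j; rewrite !(mxE _ _ i); case: split.
Qed.

End Perron.

(** * Regular splittings and comparison of companion matrices *)

(* Summing the Neumann series, [G = X + G N X >= 0]; applied to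
   [z = (N - P) u], which has [X z >= 0], this gives [- u = G z >= 0]. *)
Lemma regular_splitting_subinvariant (R : realType) (m n : nat)
    (A P N : 'M[R]_(m, n)) (u : 'cV[R]_n) :
  A = P - N -> (forall x, mx_null A x -> mx_null P x) ->
  (forall y, mx_range A y -> mx_range P y) ->
  mx_nonneg (mpinv P) -> mx_nonneg (mpinv A) -> mx_nonneg N ->
  mx_nonneg u -> mx_le u (mpinv P *m N *m u) -> u = 0.
Proof.
move=> AE nullAP rangeAP X0 G0 N0 u0 uH.
have [PXP XPX PXt XPt] := mpinvP P; have [AGA GAG AGt GAt] := mpinvP A.
have := mulmx_null_sub nullAP; have := mulmx_range_sub rangeAP.
move: (mpinv P) (mpinv A) X0 G0 uH PXP XPX PXt XPt AGA GAG AGt GAt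
  => X G X0 G0 uH PXP XPX PXt XPt AGA GAG AGt GAt PXA PGA.
(* Symmetry of the projections [G A] and [X P] turns [P G A = P] into [G A X P = X P]; [GPX] is
   obtained likewise from [A G] and [P X]. *)
have GAX : G *m A *m X = X.
  have GAXP : G *m A *m (X *m P) = X *m P.
    by apply: trmx_inj; rewrite trmx_mul GAt XPt -mulmxA [P *m _]mulmxA PGA.
  by rewrite -{1}XPX mulmxA GAXP.
have GPX : G *m P *m X = G.
  have PXAG : P *m X *m (A *m G) = A *m G by rewrite mulmxA PXA.
  have AGPX : A *m G *m (P *m X) = A *m G.
    by apply: trmx_inj; rewrite trmx_mul AGt PXt PXAG.
  by rewrite -{1}GAG -!mulmxA [A *m _]mulmxA AGPX mulmxA GAG.
have GE : G = X + G *m N *m X.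
  by rewrite -[X in X + _]GAX AE mulmxBr mulmxBl GPX subrK.
have nonneg_zero (w : 'cV[R]_n) : mx_nonneg w -> mx_le w (X *m N *m w) ->
    X *m P *m w = w -> w = 0.
  move=> w0 wH wP.
  have Xz : mx_nonneg (X *m (N *m w - P *m w)).
    by rewrite mulmxBr !mulmxA wP; apply/mx_leP.
  have Gz : mx_nonneg (G *m (N *m w - P *m w)).
    rewrite GE mulmxDl -[G *m N *m X *m _]mulmxA.
    by apply: mx_nonnegD => //; apply: mx_nonnegM => //; apply: mx_nonnegM.
  have Gzw : G *m (N *m w - P *m w) = - w.
    rewrite -mulmxBl -opprB -AE mulNmx mulmxN mulmxA; congr (- _).
    by rewrite -wP !mulmxA GAX.
  apply/matrixP => i j; apply/eqP; rewrite [X in _ == X]mxE eq_le w0 andbT.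
  by have := Gz i j; rewrite Gzw mxE oppr_ge0.
have H0 : mx_nonneg (X *m N) by apply: mx_nonnegM.
(* [u] may fail to be fixed by [X P], but [X N u] is fixed and inherits the inequality since
   [X N >= 0]. Once it vanishes, [u <= X N u = 0]. *)
have Hu0 : X *m N *m u = 0.
  apply: nonneg_zero; first exact: mx_nonnegM.
    exact: mx_le_mull.
  by rewrite !mulmxA XPX.
apply/matrixP => i j; apply/eqP; rewrite mxE eq_le u0 andbT.
by have := uH i j; rewrite Hu0 mxE.
Qed.

Lemma unitmx_of_not_spectrum1 (R : realType) (n : nat) (M : 'M[R]_n) :
  ~ spectrum M 1 -> 1%:M - M \in unitmx.
Proof.
apply: contra_notT; rewrite unitmxE unitfE negbK => /det0P[v vn0 vM].
apply/eigenvalueP; exists (map_mx (real_complex R) v); last by rewrite map_mx_eq0.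
rewrite -map_mxM scale1r; congr map_mx.
by apply/esym/eqP; rewrite -subr_eq0 -{1}[v]mulmx1 -mulmxBr vM.
Qed.

Lemma companion_spectral_radius_lt1 (R : realType) (n : nat) (B C : 'M[R]_n) :
  mx_nonneg B -> mx_nonneg C ->
  (forall u : 'cV_n, mx_nonneg u -> mx_le u ((B + C) *m u) -> u = 0) ->
  spectral_radius (block_mx B C 1%:M 0) < 1.
Proof.
move=> B0 C0 H0; apply: spectral_radius_lt => // z /(companion_subsolution B0 C0).
case=> u [u0 un0 lu]; rewrite ltNge; apply/negP => l1; apply: un0; apply: H0 => //.
move: (cmod z) l1 lu => l l1 lu i j.
have Bu0 := mx_nonnegM B0 u0 i j; have Cu0 := mx_nonnegM C0 u0 i j.
(* Since [l >= 1], [l B u + C u <= l^2 (B + C) u], and [l^2] can be cancelled. *)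
have l2 : 0 < l ^+ 2 by rewrite exprn_gt0 // (lt_le_trans ltr01).
rewrite -(ler_pM2l l2); have := lu i j; rewrite [leLHS]mxE => /le_trans; apply.
rewrite mulmxDl [leLHS]mxE [((_ *m _) + _)%R i j]mxE mulrDr.
apply: lerD; last by rewrite ler_peMl // exprn_ege1.
by rewrite mxE ler_wpM2r // expr2 ler_peMl // (le_trans ler01).
Qed.

Lemma companion_spectral_radius_le (R : realType) (n : nat)
    (B1 C1 B2 C2 : 'M[R]_n) :
  mx_nonneg B1 -> mx_nonneg C1 -> mx_nonneg B2 -> mx_nonneg C2 ->
  mx_le (B1 + C1) (B2 + C2) -> mx_le B2 B1 ->
  spectral_radius (block_mx B1 C1 1%:M 0) < 1 ->
  spectral_radius (block_mx B1 C1 1%:M 0)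
    <= spectral_radius (block_mx B2 C2 1%:M 0).
Proof.
move=> B10 C10 B20 C20 leD leB rho1.
apply: spectral_radius_le => [|z zW]; first exact: spectral_radius_ge0.
have l1 : cmod z < 1 by apply: le_lt_trans (spectral_radius_ge zW) rho1.
have [u [u0 un0 lu]] := companion_subsolution B10 C10 zW.
have l0 := cmod_ge0 z.
apply: (companion_spectral_radius_ge _ _ u0) => //; apply: mx_le_trans lu _.
(* [l B + C = l (B + C) + (1 - l) C] and [0 <= l <= 1]. *)
have leC : mx_le C1 C2.
  by move=> i j; have := leD i j; have := leB i j; rewrite !mxE; lra.
apply/mx_leP.
have -> : cmod z *: (B2 *m u) + C2 *m u - (cmod z *: (B1 *m u) + C1 *m u)
    = (cmod z *: (B2 + C2 - (B1 + C1)) + (1 - cmod z) *: (C2 - C1)) *m u.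
  rewrite !scalemxAl -!mulmxDl -mulmxBl; congr (_ *m _).
  by apply/matrixP => i j; rewrite !mxE; ring.
apply: mx_nonnegM => //; apply: mx_nonnegD; apply: mx_nonnegZ => //.
- exact/mx_leP.
- by rewrite subr_ge0 ltW.
- exact/mx_leP.
Qed.

(* [A - S P1^+ A = P - N] with [N = Q - S P1^+ Q1 + S P1^+ S1] is again a proper
   regular splitting. *)
Lemma induced_splitting (R : realType) (m n : nat)
    (A P Q S P1 Q1 S1 : 'M[R]_(m, n)) :
  double_proper_weak_regular A P1 Q1 S1 ->
  double_proper_regular A P Q S ->
  (forall x, mx_null P x -> mx_null S x) ->
  (forall y, mx_range S y -> mx_range P y) ->
  ~ spectrum (S *m mpinv P1) 1 ->
  mx_nonneg (mpinv ((1%:M - S *m mpinv P1) *m A)) ->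
  let B := mpinv P *m Q - mpinv P *m S *m mpinv P1 *m Q1 in
  let C := mpinv P *m S *m mpinv P1 *m S1 in
  [/\ mx_nonneg B, mx_nonneg C,
    mpinv P *m ((1%:M - S *m mpinv P1) *m A) = mpinv P *m P - (B + C) &
    forall u : 'cV_n, mx_nonneg u -> mx_le u ((B + C) *m u) -> u = 0].
Proof.
move=> [[AE1 rangeP1 nullP1] X10 XQ10 XS10] [[AE rangeP nullP] X0 Q0 S0].
move=> nullPS rangeSP /unitmx_of_not_spectrum1 unitT G0 B C.
have SQ10 : mx_nonneg (- (S *m (mpinv P1 *m Q1))).
  by rewrite -mulNmx; apply: mx_nonnegM => //; apply: mx_nonnegN.
have SS10 : mx_nonneg (S *m (mpinv P1 *m S1)).
  rewrite -[S *m _]opprK -mulNmx -mulmxN.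
  by apply: mx_nonnegM; apply: mx_nonnegN.
have SP1 : S *m mpinv P1 *m P1 = S.
  by apply: mulmx_null_sub => x; rewrite nullP1 -nullP; apply: nullPS.
pose N := Q - S *m (mpinv P1 *m Q1) + S *m (mpinv P1 *m S1).
have N0 : mx_nonneg N by apply: mx_nonnegD => //; apply: mx_nonnegD.
(* Expanding the second [A] by its first splitting produces [S P1^+ P1 = S], which cancels the [S]
   of [A = P - Q + S]. *)
have hAE : (1%:M - S *m mpinv P1) *m A = P - N.
  rewrite mulmxBl mul1mx {2}AE1 mulmxDr mulmxBr SP1 AE /N -!mulmxA.
  by apply/matrixP => i j; rewrite !(mxE _ _ i j); ring.
have XN : mpinv P *m N = B + C by rewrite /N mulmxDr mulmxBr !mulmxA.
split.
- rewrite /B -!mulmxA -mulmxBr; apply: mx_nonnegM => //; exact: mx_nonnegD.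
- by rewrite /C -!mulmxA; apply: mx_nonnegM.
- by rewrite hAE mulmxBr XN.
rewrite -XN => u; apply: (regular_splitting_subinvariant hAE) => //.
(* The invertible factor [1 - S P1^+] leaves the null space of [A] unchanged. *)
- move=> x; rewrite nullP /mx_null /= -mulmxA => TAx0.
  by rewrite -(mulKmx unitT (A *m x)) TAx0 mulmx0.
(* Both [A x] and [S P1^+ A x] lie in the range of [P], hence so does their difference. *)
- move=> y [x ->]; rewrite mulmxBl mul1mx mulmxBl.
  have [a ->] : mx_range P (A *m x) by rewrite rangeP; exists x.
  have [|b ->] := rangeSP (S *m mpinv P1 *m A *m x).
    by rewrite -!mulmxA; exists (mpinv P1 *m (A *m x)).
  by exists (a - b); rewrite mulmxBr.
Qed.

Unset Implicit Arguments.

Theorem theorem3p11 (R : realType) (m n : nat)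
  (A P1 R1 S1 P2 R2 S2 P3 R3 S3 : 'M[R]_(m, n)) :
  semi_monotone A ->
  double_proper_weak_regular A P1 R1 S1 ->
  double_proper_weak_regular A P2 R2 S2 ->
  double_proper_regular A P3 R3 S3 ->
  (forall x, mx_null P3 x -> mx_null S3 x) ->
  (forall y, mx_range S3 y -> mx_range P3 y) ->
  ~ spectrum (S3 *m mpinv P1) 1 ->
  ~ spectrum (S3 *m mpinv P2) 1 ->
  let hA1 := (1%:M - S3 *m mpinv P1) *m A in
  let hA2 := (1%:M - S3 *m mpinv P2) *m A in
  mx_nonneg (mpinv hA1) ->
  mx_nonneg (mpinv hA2) ->
  let hP1 := P3 in
  let hP2 := P3 in
  let hR1 := R3 - S3 *m mpinv P1 *m R1 in
  let hR2 := R3 - S3 *m mpinv P2 *m R2 in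
  mx_le (mpinv hP2 *m hA2) (mpinv hP1 *m hA1) ->
  mx_le (mpinv hP2 *m hR2) (mpinv hP1 *m hR1) ->
  let W13 := block_mx (mpinv P3 *m R3 - mpinv P3 *m S3 *m mpinv P1 *m R1)
                      (mpinv P3 *m S3 *m mpinv P1 *m S1) 1%:M 0 in
  let W23 := block_mx (mpinv P3 *m R3 - mpinv P3 *m S3 *m mpinv P2 *m R2)
                      (mpinv P3 *m S3 *m mpinv P2 *m S2) 1%:M 0 in
  spectral_radius W13 <= spectral_radius W23 /\ spectral_radius W23 < 1.
Proof.
move=> _ wreg1 wreg2 reg3 nullPS rangeSP nsp1 nsp2 hA1 hA2 G10 G20 hP1 hP2.
move=> hR1 hR2 leA leR W13 W23.
have [B10 C10 XA1 sub1] := induced_splitting wreg1 reg3 nullPS rangeSP nsp1 G10.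
have [B20 C20 XA2 sub2] := induced_splitting wreg2 reg3 nullPS rangeSP nsp2 G20.
split; last exact: companion_spectral_radius_lt1.
apply: companion_spectral_radius_le => //.
(* Here [P3^+ hAi = P3^+ P3 - (Bi + Ci)], so [leA] reverses into [B1 + C1 <= B2 + C2]; [leR] is
   [B2 <= B1] itself. *)
- apply/mx_leP; have /mx_leP := leA; rewrite /hA1 /hA2 XA1 XA2.
  by rewrite opprB addrC addrA subrK.
- by have := leR; rewrite /hR1 /hR2 !mulmxBr !mulmxA.
- exact: companion_spectral_radius_lt1.
Qed.
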